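(* Let $A$ be an associative algebra over a field $K$, $(M,\triangleright,\triangleleft)$ an $A$-bimodule and $R,S:M\to A$ two linear maps. Define, for all $a\in A$ and $x,y\in M$, linear maps $$\succ:M\otimes A\to A,\ x\succ a=R(x)a;\qquad \prec:A\otimes M\to A,\ a\prec x=aS(x);$$ $$\gtrdot:M\otimes M\to M,\ x\gtrdot y=R(x)\triangleright y;\qquad \lessdot:M\otimes M\to M,\ x\lessdot y=x\triangleleft S(y).$$ Then: (a) If $(A,M,R,S)$ is an $\mathcal{O}$-operator system associated to $(M,\triangleright,\triangleleft)$, then $(M,A,\lessdot,\gtrdot,\prec,\succ)$ is a dendriform system. (b) If $A$ is a non-degenerate associative algebra or $M$ is a faithful $A$-bimodule, and $(M,A,\lessdot,\gtrdot,\prec,\succ)$ is a dendriform system, then $(A,M,R,S)$ is an $\mathcal{O}$-operator system associated to $(M,\triangleright,\triangleleft)$.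
   Context: All vector spaces, linear maps and tensor products are over a field $K$; associative algebras are not assumed to be unital. An $A$-bimodule $(M,\triangleright,\triangleleft)$ is a vector space $M$ with linear maps $\triangleright:A\otimes M\to M$, $\triangleleft:M\otimes A\to M$ such that $a\triangleright(b\triangleright x)=(ab)\triangleright x$, $(x\triangleleft a)\triangleleft b=x\triangleleft(ab)$, $(a\triangleright x)\triangleleft b=a\triangleright(x\triangleleft b)$ for all $a,b\in A$, $x\in M$. It is faithful if $a\triangleright M=0$ implies $a=0$ and, simultaneously, $M\triangleleft a=0$ implies $a=0$. An associative algebra $A$ is non-degenerate if, for $a\in A$, $aA=0$ implies $a=0$ and $Aa=0$ implies $a=0$. $\mathcal{O}$-operator system: $(A,M,R,S)$ is an $\mathcal{O}$-operator system associated to $(M,\triangleright,\triangleleft)$ if for all $x,y\in M$: $R(x)R(y)=R(R(x)\triangleright y+x\triangleleft S(y))$ and $S(x)S(y)=S(R(x)\triangleright y+x\triangleleft S(y))$. Dendriform system: a tuple $(B,N,\prec_B,\succ_B,\prec_N,\succ_N)$ of vector spaces $B,N$ and linear maps $\prec_B,\succ_B:B\otimes B\to B$, $\prec_N:N\otimes B\to N$, $\succ_N:B\otimes N\to N$ such that for all $a,b,c\in B$, $n\in N$: (i) $(a\prec_B b)\prec_B c=a\prec_B(b\succ_B c+b\prec_B c)$, $a\succ_B(b\prec_B c)=(a\succ_B b)\prec_B c$, $a\succ_B(b\succ_B c)=(a\succ_B b+a\prec_B b)\succ_B c$; (ii) $(n\prec_N a)\prec_N b=n\prec_N(a\succ_B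 b+a\prec_B b)$, $a\succ_N(n\prec_N b)=(a\succ_N n)\prec_N b$, $a\succ_N(b\succ_N n)=(a\succ_B b+a\prec_B b)\succ_N n$. In the claim, $B=M$, $N=A$, $\prec_B=\lessdot$, $\succ_B=\gtrdot$, $\prec_N=\prec$, $\succ_N=\succ$. *)

(* Defs.v *)
From HB Require Import structures.
From mathcomp Require Import all_boot all_algebra.
Set Implicit Arguments.
Unset Strict Implicit.
Unset Printing Implicit Defensive.
Import GRing.Theory.
Local Open Scope ring_scope.

(* A possibly non-unital associative K-algebra is a vector space A with a
   product mul : {bilinear A -> A -> A} satisfying [associative mul]:
   MathComp's own algebra structures all have a unit.  Linear maps out of
   U \otimes V are represented by bilinear maps on U and V. *)

Record is_bimodule (K : fieldType) (A M : lmodType K)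
    (mul : {bilinear A -> A -> A})
    (lact : {bilinear A -> M -> M}) (ract : {bilinear M -> A -> M}) : Prop :=
  IsBimodule {
    lactM : forall a b x, lact a (lact b x) = lact (mul a b) x;
    ractM : forall x a b, ract (ract x a) b = ract x (mul a b);
    lractA : forall a x b, ract (lact a x) b = lact a (ract x b)
  }.

Definition faithful_bimodule (K : fieldType) (A M : lmodType K)
    (lact : {bilinear A -> M -> M}) (ract : {bilinear M -> A -> M}) : Prop :=
  (forall a : A, (forall x : M, lact a x = 0) -> a = 0) /\
  (forall a : A, (forall x : M, ract x a = 0) -> a = 0).

Definition nondegenerate_algebra (K : fieldType) (A : lmodType K)
    (mul : {bilinear A -> A -> A}) : Prop :=
  (forall a : A, (forall b : A, mul a b = 0) -> a = 0) /\
  (forall a : A, (forall b : A, mul b a = 0) -> a = 0).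

Definition is_O_operator_system (K : fieldType) (A M : lmodType K)
    (mul : {bilinear A -> A -> A})
    (lact : {bilinear A -> M -> M}) (ract : {bilinear M -> A -> M})
    (R S : {linear M -> A}) : Prop :=
  forall x y : M,
    mul (R x) (R y) = R (lact (R x) y + ract x (S y)) /\
    mul (S x) (S y) = S (lact (R x) y + ract x (S y)).

Record is_dendriform_system (K : fieldType) (B N : lmodType K)
    (precB succB : {bilinear B -> B -> B})
    (precN : {bilinear N -> B -> N}) (succN : {bilinear B -> N -> N}) : Prop :=
  IsDendriformSystem {
    dendB_prec : forall a b c : B,
      precB (precB a b) c = precB a (succB b c + precB b c);
    dendB_mid : forall a b c : B,
      succB a (precB b c) = precB (succB a b) c;
    dendB_succ : forall a b c : B,
      succB a (succB b c) = succB (succB a b + precB a b) c;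
    dendN_prec : forall (n : N) (a b : B),
      precN (precN n a) b = precN n (succB a b + precB a b);
    dendN_mid : forall (a : B) (n : N) (b : B),
      succN a (precN n b) = precN (succN a n) b;
    dendN_succ : forall (a b : B) (n : N),
      succN a (succN b n) = succN (succB a b + precB a b) n
  }.

Section InducedOperations.
Variables (K : fieldType) (A M : lmodType K).
Variables (mul : {bilinear A -> A -> A}).
Variables (lact : {bilinear A -> M -> M}) (ract : {bilinear M -> A -> M}).
Variables (R S : {linear M -> A}).

Definition alg_succ (x : M) (a : A) : A := mul (R x) a.
Definition alg_prec (a : A) (x : M) : A := mul a (S x).
Definition mod_succ (x y : M) : M := lact (R x) y.
Definition mod_prec (x y : M) : M := ract x (S y).

Fact alg_succ_bilinear : bilinear_for *:%R *:%R alg_succ.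
Proof.
by split=> [a|x] k u v; rewrite /alg_succ ?linearP // linearPl.
Qed.

Fact alg_prec_bilinear : bilinear_for *:%R *:%R alg_prec.
Proof.
by split=> [x|a] k u v; rewrite /alg_prec ?linearP // linearPl.
Qed.

Fact mod_succ_bilinear : bilinear_for *:%R *:%R mod_succ.
Proof.
by split=> [y|x] k u v; rewrite /mod_succ ?linearP // linearPl.
Qed.

Fact mod_prec_bilinear : bilinear_for *:%R *:%R mod_prec.
Proof.
by split=> [y|x] k u v; rewrite /mod_prec ?linearP // linearPl.
Qed.

HB.instance Definition _ :=
  bilinear_isBilinear.Build K M A A *:%R *:%R alg_succ alg_succ_bilinear.
HB.instance Definition _ :=
  bilinear_isBilinear.Build K A M A *:%R *:%R alg_prec alg_prec_bilinear.
HB.instance Definition _ :=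
  bilinear_isBilinear.Build K M M M *:%R *:%R mod_succ mod_succ_bilinear.
HB.instance Definition _ :=
  bilinear_isBilinear.Build K M M M *:%R *:%R mod_prec mod_prec_bilinear.
End InducedOperations.

(* Main.v *)
Require Import Defs.
From HB Require Import structures.
From mathcomp Require Import all_boot all_algebra.
Set Implicit Arguments.
Unset Strict Implicit.
Unset Printing Implicit Defensive.
Import GRing.Theory.
Local Open Scope ring_scope.

(** Write [x * y] for [R x |> y + x <| S y], the total product on [M].  By
    associativity and the bimodule laws, the two middle dendriform identities
    hold for arbitrary [R] and [S], and each of the other four says that one
    of the elements [R x R y - R (x * y)], [S x S y - S (x * y)] of [A] acts
    by zero, on the left and on the right respectively, on [M] or on [A].
    An O-operator system is one where these elements vanish, whence (a).
    Conversely, non-degeneracy lets one cancel the actions on [A], and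
    faithfulness those on [M], whence (b). *)

(** Left and right cancellation for bilinear maps: an element of the first
    (or second) factor is determined by its pairings as soon as only zero
    pairs to zero with everything. *)
Lemma bilinear_injl (K : fieldType) (U V W : lmodType K)
    (f : {bilinear U -> V -> W}) :
  (forall u, (forall v, f u v = 0) -> u = 0) ->
  forall u u', (forall v, f u v = f u' v) -> u = u'.
Proof.
move=> f0 u u' fuu'; apply/subr0_eq/f0 => v.
by rewrite linearBl fuu' subrr.
Qed.

Lemma bilinear_injr (K : fieldType) (U V W : lmodType K)
    (f : {bilinear U -> V -> W}) :
  (forall v, (forall u, f u v = 0) -> v = 0) ->
  forall v v', (forall u, f u v = f u v') -> v = v'.
Proof.
move=> f0 v v' fvv'; apply/subr0_eq/f0 => u.
by rewrite linearBr fvv' subrr.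
Qed.

Theorem proposition3p24 (K : fieldType)
    (A : lmodType K) (mul : {bilinear A -> A -> A}) (mulA : associative mul)
    (M : lmodType K)
    (lact : {bilinear A -> M -> M}) (ract : {bilinear M -> A -> M})
    (bimodM : is_bimodule mul lact ract)
    (R S : {linear M -> A}) :
  (is_O_operator_system mul lact ract R S ->
   is_dendriform_system (mod_prec ract S) (mod_succ lact R)
                        (alg_prec mul S) (alg_succ mul R)) /\
  (nondegenerate_algebra mul \/ faithful_bimodule lact ract ->
   is_dendriform_system (mod_prec ract S) (mod_succ lact R)
                        (alg_prec mul S) (alg_succ mul R) ->
   is_O_operator_system mul lact ract R S).
Proof.
case: bimodM => lM rM lrA; split=> [RS | ndeg [precM _ succM precA _ succA]].
  split=> [a b c | a b c | a b c | n a b | a n b | a b n];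
    rewrite /= /mod_prec /mod_succ /alg_prec /alg_succ.
  - by rewrite rM (RS b c).2.
  - by rewrite lrA.
  - by rewrite lM (RS a b).1.
  - by rewrite -mulA (RS a b).2.
  - by rewrite mulA.
  - by rewrite mulA (RS a b).1.
move=> x y; case: ndeg => [[mulI0l mulI0r] | [lact0 ract0]]; split.
- by apply: (bilinear_injl mulI0l) => a; rewrite -mulA; apply: succA.
- by apply: (bilinear_injr mulI0r) => a; rewrite mulA; apply: precA.
- by apply: (bilinear_injl lact0) => m; rewrite -lM; apply: succM.
- by apply: (bilinear_injr ract0) => m; rewrite -rM; apply: precM.
Qed.
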